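(* Let $d\ge 2$ and $n,k\ge 0$ be integers. Then $N_d(n,k)$ equals the number of labelled ordered trees in $\widetilde{\mathcal{T}}_d$ with $n+1$ edges and $k+1$ leaves.
   Context: $N_d(n,k) = \frac{1}{n+1} \binom{n+1}{k+1} \binom{ n + (n-k)(d-2)+1}{k}$. An ordered tree is a rooted tree in which the children of each vertex are linearly ordered; the outdegree of a vertex is its number of children, leaves have outdegree $0$ and internal nodes positive outdegree. $\widetilde{\mathcal{T}}_d$ is the set of ordered trees together with labellings such that the root is an internal node and is unlabelled, and every non-root internal node with outdegree $\ell\ge 1$ is labelled by a composition of $\ell-1$ into $d-1$ nonnegative parts (leaves are unlabelled). *)

(* Defs.v *)
From mathcomp Require Import all_boot all_order all_algebra.
From mathcomp Require Import boolp classical_sets functions cardinality.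

Set Implicit Arguments.
Unset Strict Implicit.
Unset Printing Implicit Defensive.

Import GRing.Theory.

Local Open Scope nat_scope.

(* A vertex carries an optional label ([None] = unlabelled) and the ordered
   list of its subtrees. *)
Inductive ltree : Type := LNode of option (seq nat) & seq ltree.

Definition label (t : ltree) : option (seq nat) := let: LNode l _ := t in l.

Definition children (t : ltree) : seq ltree := let: LNode _ cs := t in cs.

Definition outdegree (t : ltree) : nat := size (children t).

Fixpoint edges (t : ltree) : nat :=
  let: LNode _ cs := t in sumn [seq (edges c).+1 | c <- cs].

Fixpoint leaves (t : ltree) : nat :=
  let: LNode _ cs := t in
  if cs is [::] then 1 else sumn [seq leaves c | c <- cs].

Definition is_composition (m r : nat) (c : seq nat) : bool :=
  (size c == r) && (sumn c == m).

Definition nonroot_label_ok (d : nat) (t : ltree) : bool :=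
  if outdegree t == 0 then label t == None
  else if label t is Some c then is_composition (outdegree t - 1) (d - 1) c
  else false.

Fixpoint nonroot_ok (d : nat) (t : ltree) : bool :=
  nonroot_label_ok d t && (let: LNode _ cs := t in all (nonroot_ok d) cs).

Definition in_Ttilde (d : nat) (t : ltree) : bool :=
  [&& 0 < outdegree t, label t == None & all (nonroot_ok d) (children t)].

Local Open Scope ring_scope.

(* The subtractions are in [nat], with d >= 2 intended; [n - k] truncates only
   for k > n, where the first binomial coefficient is 0. *)
Definition N_ (d n k : nat) : rat :=
  (n.+1%:R)^-1 * 'C(n.+1, k.+1)%:R * 'C(n + (n - k) * (d - 2) + 1, k)%:R.

(* Main.v *)
Require Import Defs.
From mathcomp Require Import all_boot all_order all_algebra.
From mathcomp Require Import boolp classical_sets functions cardinality.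
From mathcomp Require Import zify ring.
From HB Require Import structures.

(* Write q = d - 1 and let A(r, n, k) count the ordered forests of r non-root trees
   with n vertices and k leaves. Deleting the root of the first tree gives
     A(r+1, n+1, k) = A(r, n, k-1) + sum_i <q, i> A(r+i+1, n, k),
   where <q, i> is the number of compositions of i into q parts: a label c forces
   outdegree sumn c + 1, so the deletion is reversible. By the convolution identity
   sum_i <a, i> <b, m-i> = <a+b, m>, induction on n yields
     n A(r, n, k) = r C(n, k) <q (n-k), k-r>,
   and summing over the root degree r, with r = <2, r-1>, gives N_d(n, k). *)

Set Implicit Arguments.
Unset Strict Implicit.
Unset Printing Implicit Defensive.

Local Open Scope nat_scope.

(** Equality of trees is decided classically, so that trees can be collected in duplicate-free
    lists. *)
HB.instance Definition _ := gen_eqMixin ltree.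

(** * Multiset coefficients *)

(* The coefficient of t^m in (1 - t)^(-q); binomial notation would be wrong at
   q = 0 because of truncated subtraction. *)
Definition multichoose (q m : nat) : nat :=
  if q is q'.+1 then 'C(m + q', m) else (m == 0).

Lemma multichoose0 q : multichoose q 0 = 1.
Proof. by case: q => //= q; rewrite bin0. Qed.

Lemma multichooseSS q m :
  multichoose q.+1 m.+1 = multichoose q.+1 m + multichoose q m.+1.
Proof.
case: q => [|q] /=; first by rewrite !addn0 !binn.
by rewrite addSn binS addnS -addSn addnC.
Qed.

Lemma mul_multichoose q m :
  m.+1 * multichoose q m.+1 = q * multichoose q.+1 m.
Proof.
case: q => [|q] /=; first by rewrite muln0.
rewrite mul_bin_left addSn -addnS; congr (_ * _); lia.
Qed.

(** Compares coefficients in (1 - t)^(-a) (1 - t)^(-b); induction on a, then on m, with the Pascal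
    rule [multichooseSS]. *)
Lemma multichoose_conv a b m :
  \sum_(i < m.+1) multichoose a i * multichoose b (m - i) = multichoose (a + b) m.
Proof.
elim: a m => [|a IHa] m.
  rewrite big_ord_recl /= subn0 mul1n big1 ?addn0 // => i _.
elim: m => [|m IHm].
  by rewrite big_ord1 !multichoose0.
rewrite addSn multichooseSS -addSn -IHm -IHa big_ord_recl.
rewrite [X in _ = _ + X]big_ord_recl !multichoose0 addnCA; congr (_ + _).
rewrite -big_split; apply: eq_bigr => i _ /=.
by rewrite /bump leq0n add1n subSS -mulnDl -multichooseSS.
Qed.

(* With i * <q, i> = q * <q + 1, i - 1>, the weighted convolution reduces to the
   plain one; both sides are scaled by j + 1 so that no division occurs. *)
Lemma multichoose_conv_weighted q j m :
  j.+1 * (\sum_(i < m.+1) i * (multichoose q i * multichoose (q * j) (m - i)))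
  = m * multichoose (q * j.+1) m.
Proof.
rewrite big_ord_recl mul0n add0n.
case: m => [|m]; first by rewrite big_ord0 muln0.
under eq_bigr => i _ do rewrite lift0 subSS mulnA mul_multichoose -mulnA.
by rewrite -big_distrr multichoose_conv mul_multichoose addSn -mulnS mulnCA mulnA.
Qed.

(** * Enumeration of compositions *)

Fixpoint compositions (q m : nat) : seq (seq nat) :=
  if q is q'.+1 then
    flatten [seq map (cons a) (compositions q' (m - a)) | a <- iota 0 m.+1]
  else if m == 0 then [:: [::]] else [::].

Lemma compositionsS q m :
  compositions q.+1 m =
    flatten [seq map (cons a) (compositions q (m - a)) | a <- iota 0 m.+1].
Proof. by []. Qed.

(** The map [key] recovers from an element the index of its block, so distinct blocks are
    disjoint. *)
Lemma uniq_flatten_map (S T : eqType) (F : S -> seq T) (key : T -> S) (s : seq S) :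
    uniq s -> (forall x, uniq (F x)) -> (forall x y, y \in F x -> key y = x) ->
  uniq (flatten (map F s)).
Proof.
move=> + uF keyF; elim: s => //= x s IHs /andP[xs us].
rewrite cat_uniq uF IHs // andbT; apply/hasPn => y /flatten_mapP[z zs yz].
by apply: contra xs => /keyF <-; rewrite (keyF _ _ yz).
Qed.

Lemma size_flatten_map (T : Type) (F : nat -> seq T) (m : nat) :
  size (flatten [seq F i | i <- iota 0 m]) = \sum_(i < m) size (F i).
Proof.
rewrite size_flatten /shape -map_comp sumnE big_map.
by rewrite -(big_mkord xpredT (fun i => size (F i))) /index_iota subn0.
Qed.

Lemma mem_compositions q m c : (c \in compositions q m) = is_composition m q c.
Proof.
elim: q m c => [|q IHq] m c.
  by rewrite /= /is_composition eq_sym; case: m c => [|m] [|a c].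
rewrite compositionsS; apply/flatten_mapP/idP => [[a] | ].
  rewrite mem_iota => am /mapP[c']; rewrite IHq /is_composition.
  by move=> /andP[/eqP sc /eqP mc] -> /=; rewrite sc mc subnKC ?eqxx.
rewrite /is_composition; case: c => // a c /andP[sc /eqP mc].
rewrite -mc; exists a; first by rewrite mem_iota /=; lia.
by apply: map_f; rewrite IHq /is_composition -eqSS sc /= addKn eqxx.
Qed.

Lemma uniq_compositions q m : uniq (compositions q m).
Proof.
elim: q m => [|q IHq] m; first by rewrite /=; case: eqP.
rewrite compositionsS.
apply: (@uniq_flatten_map _ _ _ (head 0)) => [|a|a c /mapP[c' _ ->] //].
  exact: iota_uniq.
by rewrite map_inj_uniq // => ? ? [].
Qed.

Lemma size_compositions q m : size (compositions q m) = multichoose q m.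
Proof.
elim: q m => [|q IHq] m; first by rewrite /=; case: eqP.
rewrite compositionsS size_flatten_map -[RHS](multichoose_conv 1 q).
by apply: eq_bigr => i _; rewrite size_map IHq /= addn0 binn mul1n.
Qed.

(** * Enumeration of forests *)

Definition fverts (fs : seq ltree) : nat := sumn [seq (edges t).+1 | t <- fs].

Definition fleaves (fs : seq ltree) : nat := sumn [seq leaves t | t <- fs].

Lemma fverts_cat fs gs : fverts (fs ++ gs) = fverts fs + fverts gs.
Proof. by rewrite /fverts map_cat sumn_cat. Qed.

Lemma fleaves_cons t fs : fleaves (t :: fs) = leaves t + fleaves fs.
Proof. by []. Qed.

Lemma fleaves_cat fs gs : fleaves (fs ++ gs) = fleaves fs + fleaves gs.
Proof. by rewrite /fleaves map_cat sumn_cat. Qed.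

Lemma leaves_gt0 : forall t, 0 < leaves t.
Proof.
(* The generated induction principle of this nested type gives no hypothesis on subtrees. *)
fix leaves_gt0 1 => -[l [|t cs]] //=.
by rewrite addn_gt0 leaves_gt0.
Qed.

Lemma size_fleaves fs : size fs <= fleaves fs.
Proof.
by elim: fs => //= t fs; have := leaves_gt0 t; rewrite /fleaves /=; lia.
Qed.

Definition leaf : ltree := LNode None [::].

(* Deleting the root of the first tree of a forest is undone by [graft]: the
   label of that root determines how many trees to put back below it. *)
Definition graft (c : seq nat) (fs : seq ltree) : seq ltree :=
  LNode (Some c) (take (sumn c).+1 fs) :: drop (sumn c).+1 fs.

Lemma graft_inj c c' fs fs' : graft c fs = graft c' fs' -> c = c' /\ fs = fs'.
Proof.
case=> <- eq_take eq_drop; split=> //.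
by rewrite -(cat_take_drop (sumn c).+1 fs) eq_take eq_drop cat_take_drop.
Qed.

(** Bounding i by k loses nothing: every tree has a leaf, so r' + i + 1 trees with k leaves force i
    < k. *)
Fixpoint forests (q r n k : nat) : seq (seq ltree) :=
  match n, r with
  | 0, _ => if (r == 0) && (k == 0) then [:: [::]] else [::]
  | _.+1, 0 => [::]
  | n'.+1, r'.+1 =>
      (if k is k'.+1 then map (cons leaf) (forests q r' n' k') else [::]) ++
      flatten [seq [seq graft c fs | c <- compositions q i,
                                     fs <- forests q (r' + i.+1) n' k]
              | i <- iota 0 k]
  end.

Definition is_forest (d r n k : nat) (fs : seq ltree) : bool :=
  [&& size fs == r, all (nonroot_ok d) fs, fverts fs == n & fleaves fs == k].

Lemma leaves_node l cs : 0 < size cs -> leaves (LNode l cs) = fleaves cs.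
Proof. by case: cs. Qed.

Lemma is_forest_graft d r n k c fs :
    is_composition (sumn c) (d - 1) c -> is_forest d (r + (sumn c).+1) n k fs ->
  is_forest d r.+1 n.+1 k (graft c fs).
Proof.
move=> cc /and4P[/eqP sz ok /eqP nv /eqP kl].
have st : size (take (sumn c).+1 fs) = (sumn c).+1 by rewrite size_takel ?sz ?leq_addl.
move: ok; rewrite -{1}(cat_take_drop (sumn c).+1 fs) all_cat => /andP[okt okd].
apply/and4P; split.
- by rewrite /= size_drop sz addnK.
- by rewrite /= okd okt /nonroot_label_ok /outdegree /= st subn1 cc.
- by rewrite /fverts /= addSn -fverts_cat cat_take_drop nv.
- rewrite fleaves_cons leaves_node ?st //.
  by rewrite -fleaves_cat cat_take_drop kl.
Qed.

Lemma mem_forests d r n k fs :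
  (fs \in forests (d - 1) r n k) = is_forest d r n k fs.
Proof.
elim: n r k fs => [|n IHn] r k fs /=.
  case: fs => [|t fs].
    by rewrite /is_forest /= ![0 == _]eq_sym; case: r => [|r]; case: k.
  by rewrite /is_forest /= andbF andbF; case: ifP.
case: r => [|r]; first by case: fs => [|[l cs] fs]; rewrite /is_forest.
rewrite mem_cat; apply/orP/idP => [[]|].
- case: k => // k /mapP[gs]; rewrite IHn => /and4P[sz ok nv kl] ->.
  by rewrite /is_forest /= ok /fverts /fleaves /= eqSS sz eqSS nv eqSS kl.
- move=> /flatten_mapP[i _ /allpairsP[[c gs] [/= ]]].
  rewrite mem_compositions IHn => cc fgs ->.
  have /andP[_ /eqP ic] := cc; rewrite -ic in cc fgs.
  exact: is_forest_graft.
case: fs => [|[l cs] fs]; first by rewrite /is_forest.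
rewrite /is_forest => /and4P[/eqP[sz] /= /andP[/andP[lok ok] okfs]].
rewrite /fverts /= -/(fverts cs) -/(fverts fs) addSn eqSS => /eqP nv.
rewrite fleaves_cons => /eqP kl.
move: lok; rewrite /nonroot_label_ok /outdegree /= size_eq0.
(* Either the first tree is a single leaf, or its root is labelled and [graft] restores it. *)
case: (eqVneq cs [::]) nv kl => [->|cs0] nv kl.
  move=> /eqP ->; left; rewrite -kl add1n; apply: map_f.
  by rewrite IHn /is_forest sz okfs -nv !eqxx.
case: l kl => // c kl cc; right.
have cs_gt0 : 0 < size cs by rewrite lt0n size_eq0.
have scs : (sumn c).+1 = size cs by case/andP: cc => _ /eqP ->; lia.
rewrite leaves_node // -fleaves_cat in kl.
have szk := size_fleaves (cs ++ fs); rewrite kl size_cat sz in szk.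
apply/flatten_mapP; exists (sumn c); first by rewrite mem_iota; lia.
apply/allpairsP; exists (c, cs ++ fs); split=> /=.
- by rewrite mem_compositions; case/andP: cc => cc _; rewrite /is_composition cc /=.
- rewrite IHn /is_forest size_cat all_cat okfs ok sz fverts_cat nv kl scs.
  by rewrite addnC !eqxx.
- by rewrite /graft scs take_size_cat // drop_size_cat.
Qed.

Lemma uniq_forests q r n k : uniq (forests q r n k).
Proof.
elim: n r k => [|n IHn] r k /=; first by case: ifP.
case: r => // r; rewrite cat_uniq; apply/and3P; split.
- by case: k => // k; rewrite map_inj_uniq // => ? ? [].
- apply/hasPn => fs /flatten_mapP[i _ /allpairsP[[c gs] [_ _ ->]]] /=.
  by case: k => // k; apply/mapP => -[].
(* The key reads i off as the sum of the first root's label. *)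
apply: (@uniq_flatten_map _ _ _
   (fun fs => sumn (odflt [::] (label (head leaf fs))))).
- exact: iota_uniq.
- move=> i; apply: allpairs_uniq => // [|[c fs] [c' fs'] _ _ /= /graft_inj[]].
    exact: uniq_compositions.
  by move=> -> ->.
- move=> i fs /allpairsP[[c gs] [/= + _ ->]] /=.
  by rewrite mem_compositions => /andP[_ /eqP].
Qed.

(** * Counting forests *)

Lemma size_forestsS q r n k :
  size (forests q r.+1 n.+1 k) =
    (if k is k'.+1 then size (forests q r n k') else 0)
    + \sum_(i < k) multichoose q i * size (forests q (r + i.+1) n k).
Proof.
rewrite /= size_cat size_flatten_map; congr (_ + _).
  by case: k => // k; rewrite size_map.
by apply: eq_bigr => i _; rewrite size_allpairs size_compositions.
Qed.

Lemma size_forests0 q r k : size (forests q r 0 k) = (r == 0) && (k == 0).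
Proof. by rewrite /=; case: ifP. Qed.

(** Both sides equal n (n + 1) C(n, m). *)
Lemma bin_recurrence n m :
  n.+1 * (m.+1 * 'C(n, m.+1) + m * 'C(n, m)) = m.+1 * n * 'C(n.+1, m.+1).
Proof.
have [lt_nm|le_mn] := ltnP n m.
  by rewrite !bin_small ?muln0 // ltnW.
have := mul_bin_left n m; rewrite binS.
by move: le_mn => /subnKC <-; rewrite addKn; nia.
Qed.

(* The right-hand side of Lagrange's formula n * [x^n] T^r = r * [t^(n-r)] phi^n
   for T = x * phi(T), phi(t) = y + t / (1 - t)^q, at the coefficient of y^k. *)
Definition lagrange_coef (q r n k : nat) : nat :=
  if r <= k then r * 'C(n, k) * multichoose (q * (n - k)) (k - r) else 0.

(** The sum over root labels in the recurrence, for r + m + 1 leaves. The factor r + i + 1 splits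
    into r + 1, giving a plain convolution, and i, giving the weighted one. *)
Lemma lagrange_coef_sum q r n m :
  (r + m).+1 *
    (\sum_(i < (r + m).+1) multichoose q i * lagrange_coef q (r + i.+1) n (r + m).+1)
  = (r.+1 * ((r + m).+1 * 'C(n, (r + m).+1)) + m * 'C(n, r + m))
    * multichoose (q * (n - (r + m))) m.
Proof.
set k := r + m.
(* For n <= k both sides vanish; on the right, m = 0 or [multichoose 0 m] = 0 kills the second
   term. *)
have [le_nk|lt_kn] := leqP n k.
  rewrite big1 => [|i _]; last first.
    by rewrite /lagrange_coef bin_small // !(muln0, mul0n) if_same muln0.
  have /eqP-> : n - k == 0 by rewrite subn_eq0.
  by rewrite bin_small // !muln0 add0n; case: (m) => //= p; rewrite muln0.
have [j nE] : exists j, n = k.+1 + j by exists (n - k.+1); rewrite subnKC.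
have -> : n - k = j.+1 by lia.
have -> : \sum_(i < k.+1) multichoose q i * lagrange_coef q (r + i.+1) n k.+1
   = 'C(n, k.+1) * (r.+1 * multichoose (q * j.+1) m
       + \sum_(i < m.+1) i * (multichoose q i * multichoose (q * j) (m - i))).
  rewrite mulnS -(multichoose_conv q (q * j)) [r.+1 * _]big_distrr -big_split.
  rewrite big_distrr /=.
  (* Terms with i > m vanish, since then r + i + 1 exceeds k + 1. *)
  rewrite [RHS](big_ord_widen k.+1 (fun i => 'C(n, k.+1) *
     (r.+1 * (multichoose q i * multichoose (q * j) (m - i)) +
      i * (multichoose q i * multichoose (q * j) (m - i))))); last by rewrite /k; lia.
  rewrite [RHS]big_mkcond; apply: eq_bigr => i _.
  rewrite /lagrange_coef.
  have -> : (r + i.+1 <= k.+1) = (i < m.+1) by rewrite /k; lia.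
  case: ifP => im; last by rewrite muln0.
  have -> : k.+1 - (r + i.+1) = m - i by rewrite /k; lia.
  have -> : n - k.+1 = j by lia.
  by ring.
have w := multichoose_conv_weighted q j m.
(* Trading k + 1 for j + 1 = n - k supplies the factor that [multichoose_conv_weighted] needs. *)
have b : k.+1 * 'C(n, k.+1) = j.+1 * 'C(n, k).
  by rewrite mul_bin_left; congr (_ * _); lia.
move: w b; set S := \sum_(i < _) _ => w b.
rewrite mulnA mulnDr b mulnDl; congr (_ + _); first by ring.
by rewrite mulnAC w; ring.
Qed.

Lemma size_forests q r n k :
  n.+1 * size (forests q r n.+1 k) = lagrange_coef q r n.+1 k.
Proof.
elim: n r k => [|n IHn] [|r] k.
- by rewrite /= /lagrange_coef.
- rewrite mul1n size_forestsS big1 => [|i _]; last first.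
    by rewrite size_forests0 addnS muln0.
  rewrite /lagrange_coef addn0; case: k => // k; rewrite size_forests0.
  case: k => [|k]; last by rewrite bin_small // muln0 if_same andbF.
  by case: r => //=; rewrite muln0.
- by rewrite muln0.
rewrite size_forestsS.
(* For k <= r every term of the recurrence asks for more trees than leaves, hence is zero. *)
have [lt_rk|le_kr] := ltnP r k; last first.
  rewrite /lagrange_coef ltnNge le_kr /= big1 => [|i _]; last first.
    apply/eqP; rewrite muln_eq0 -[size _ == 0](eqn_pmul2l (ltn0Sn n)).
    rewrite IHn /lagrange_coef ifF ?muln0 ?eqxx ?orbT //.
    by apply/negbTE; rewrite -ltnNge; lia.
  rewrite addn0; case: k le_kr => [|k] le_kr; first by rewrite muln0.
  apply/eqP; rewrite muln_eq0 -[size _ == 0](eqn_pmul2l (ltn0Sn n)).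
  rewrite IHn /lagrange_coef ifF ?muln0 ?eqxx ?orbT //.
  by apply/negbTE; rewrite -ltnNge.
have [m kE] : exists m, k = (r + m).+1 by exists (k - r.+1); lia.
rewrite {}kE {lt_rk}.
have sumE := lagrange_coef_sum q r n.+1 m.
have leafE := IHn r (r + m).
have bE := bin_recurrence n.+1 (r + m).
set S := \sum_(i < _) _.
have {}sumE : (r + m).+1 * (n.+1 * S) =
  (r.+1 * ((r + m).+1 * 'C(n.+1, (r + m).+1)) + m * 'C(n.+1, r + m))
    * multichoose (q * (n.+1 - (r + m))) m.
  rewrite -sumE /S [n.+1 * _]big_distrr; congr (_ * _).
  by apply: eq_bigr => i _; rewrite -IHn; exact: mulnCA.
move: sumE leafE bE; rewrite /lagrange_coef leq_addr addKn ltnS leq_addr !subSS addKn.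
move: (size _) S (multichoose _ _) 'C(n.+1, (r + m).+1) 'C(n.+1, r + m) 'C(n.+2, _).
move=> a S X C C' C'' sumE leafE bE.
(* Scaling by r + m + 1 and n + 1 lets [leafE] and [sumE] apply without division. *)
apply/eqP; rewrite -(eqn_pmul2l (ltn0Sn (r + m))) -(eqn_pmul2l (ltn0Sn n)); apply/eqP.
transitivity (n.+2 * ((r + m).+1 * (n.+1 * a) + (r + m).+1 * (n.+1 * S))).
  by ring.
rewrite sumE leafE.
transitivity (r.+1 * X * (n.+2 * ((r + m).+1 * C + (r + m) * C'))).
  by ring.
by rewrite bE; ring.
Qed.

(** * Counting trees *)

Definition trees (q n k : nat) : seq ltree :=
  flatten [seq map (LNode None) (forests q r.+1 n k) | r <- iota 0 k].

Lemma mem_trees d n k t :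
  (t \in trees (d - 1) n k) = [&& in_Ttilde d t, edges t == n & leaves t == k].
Proof.
case: t => l cs; apply/flatten_mapP/idP => [[r _ /mapP[fs]]|].
  rewrite mem_forests => /and4P[/eqP sz ok nv kl] [-> ->].
  apply/and3P; split; last by rewrite leaves_node ?sz.
    by rewrite /in_Ttilde /outdegree /= sz ok.
  (* The edges of a tree correspond to the vertices of the forest below its root. *)
  exact: nv.
case/and3P=> /and3P[cs_gt0 /eqP lE ok] nv /eqP kl.
rewrite leaves_node // in kl; move: lE => /= ->.
have := size_fleaves cs; rewrite kl => le_k.
exists (size cs).-1.
  by rewrite mem_iota /=; move: cs_gt0; rewrite /outdegree /=; lia.
apply: map_f; rewrite mem_forests prednK //.
by apply/and4P; split=> //; apply/eqP.
Qed.

Lemma uniq_trees q n k : uniq (trees q n k).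
Proof.
apply: (@uniq_flatten_map _ _ _ (fun t => (outdegree t).-1)); first exact: iota_uniq.
  by move=> r; rewrite map_inj_uniq ?uniq_forests // => ? ? [].
(* [mem_forests] is stated for d - 1, so it is used at d = q + 1. *)
move=> r t /mapP[fs + ->]; have := mem_forests q.+1 r.+1 n k fs.
by rewrite subn1 => -> /and4P[/eqP sz _ _ _]; rewrite /outdegree /= sz.
Qed.

Lemma size_trees q n k :
  n.+1 * size (trees q n.+1 k.+1) =
  'C(n.+1, k.+1) * 'C(k + q * (n - k) + 1, k).
Proof.
rewrite size_flatten_map big_distrr.
(* The summand 2 provides the weights <2, i> = i + 1, the root degrees. *)
have -> : 'C(k + q * (n - k) + 1, k) = multichoose (2 + q * (n - k)) k.
  by rewrite addn1 -addnS.
rewrite -multichoose_conv big_distrr; apply: eq_bigr => i _.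
rewrite size_map [LHS]size_forests /lagrange_coef ltn_ord !subSS /= addn1 binSn.
by ring.
Qed.

Local Open Scope classical_set_scope.
Local Open Scope card_scope.
Local Open Scope ring_scope.

Theorem theorem4p5 (d n k : nat) (hd : (2 <= d)%N) :
  exists m : nat,
    [set t : ltree | [/\ in_Ttilde d t, edges t = n.+1 & leaves t = k.+1]]
      #= `I_m
    /\ N_ d n k = m%:R.
Proof.
set s := trees (d - 1) n.+1 k.+1.
exists (size s); split.
  (* Indexing the duplicate-free list [s] gives the bijection with an initial segment. *)
  have -> : [set t : ltree | [/\ in_Ttilde d t, edges t = n.+1 & leaves t = k.+1]]
      = [set nth leaf s i | i in `I_(size s)].
    apply/seteqP; split=> t /=.
      move=> [Tt et lt]; have ts : t \in s by rewrite mem_trees Tt et lt !eqxx.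
      by exists (index t s); rewrite ?nth_index //= index_mem.
    move=> [i ilt <-]; have := mem_nth leaf ilt.
    by rewrite mem_trees => /and3P[Tt /eqP et /eqP lt].
  apply: inj_card_eq => i j; rewrite !inE /= => ilt jlt /eqP.
  by rewrite nth_uniq ?uniq_trees // => /eqP.
rewrite /N_ -GRing.mulrA -GRing.natrM.
have binE : ('C(n.+1, k.+1) * 'C(n + (n - k) * (d - 2) + 1, k) = n.+1 * size s)%N.
  rewrite size_trees; have [lt_nk|le_kn] := ltnP n k.
    by rewrite bin_small.
  (* As k <= n and d >= 2, n + (n - k)(d - 2) = k + (d - 1)(n - k). *)
  by congr (_ * 'C(_, _))%N; nia.
by rewrite binE GRing.natrM GRing.mulKf // Num.Theory.pnatr_eq0.
Qed.
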